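(* For every $n\ge2$, \[\sum_{\pi\in\mathcal{A}_n}\mathbf{x}^{\mathrm{cDes}(\pi)}=\sum_{k=0}^{n-2}\ \sum_{T\in\mathrm{SYT}((n-k-1,1^k)\oplus(1))}\mathbf{x}^{\mathrm{cDes}(T)}.\]
   Context: $\mathcal{A}_n$ is the set of arc permutations: $\pi\in\mathfrak{S}_n$ (one-line notation) such that for every $1\le j\le n$, $\{\pi(1),\dots,\pi(j)\}$ is an interval in $\mathbb{Z}_n$ (a set of cyclically consecutive residues). For $\pi\in\mathfrak{S}_n$, $\mathrm{cDes}(\pi)=\{i\in[n]:\pi(i)>\pi(i+1)\}$ with $\pi(n+1):=\pi(1)$, and $\mathbf{x}^J=\prod_{i\in J}x_i$. The skew shape $(n-k-1,1^k)\oplus(1)$ consists of two connected components: the hook $(n-k-1,1^k)$ and a single cell placed strictly northeast of it (in a row above and a column to the right of all cells of the hook). A standard Young tableau $T$ of this shape (English notation: rows and columns increasing) has descent set $\mathrm{Des}(T)$, the set of $i\in[n-1]$ such that $i+1$ is in a strictly lower row than $i$, and cyclic descent set $\mathrm{cDes}(T)=\mathrm{Des}(T)\cup\{n\}$ if $|\mathrm{Des}(T)|=k$, and $\mathrm{cDes}(T)=\mathrm{Des}(T)$ otherwise. *)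

(* Defs.v *)
From HB Require Import structures.
From mathcomp Require Import all_boot all_order all_algebra all_fingroup.
From mathcomp Require Import mpoly.
Set Implicit Arguments. Unset Strict Implicit. Unset Printing Implicit Defensive.
Import GRing.Theory.
Local Open Scope ring_scope.

(* Conventions: [n] = {1..n} is encoded by 'I_n via i |-> i-1; a permutation
   pi of [n] in one-line notation is a {perm 'I_n} (position p, value pi p,
   both shifted by 1).  The variable x_i (i in [n]) is 'X_(i-1). *)

Definition xJ (n : nat) (J : {set 'I_n}) : {mpoly int[n]} :=
  \prod_(i in J) 'X_i.

Definition cyc_interval (n j : nat) (a : 'I_n) : {set 'I_n} :=
  [set x : 'I_n | ((x + n - a) %% n < j)%N].

Definition is_arc (n : nat) (pi : 'S_n) : bool :=
  [forall j : 'I_n.+1, (0 < j)%N ==>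
     [exists a : 'I_n, [set pi p | p : 'I_n & (p < j)%N] == @cyc_interval n j a]].

Definition cDes_perm (n : nat) (pi : 'S_n) : {set 'I_n} :=
  [set p : 'I_n | (pi (ordS p) < pi p)%N].

(* Cells (row, column), rows numbered top to bottom, columns left to right
   (English notation). *)
Definition cell := (nat * nat)%type.

(* The skew shape (n-k-1, 1^k) (+) (1): the hook occupies rows 1..k+1 and
   columns 0..n-k-2, the single cell sits at row 0, column n-k-1 (strictly
   north-east of the hook). *)
Definition hook_plus_cell (n k : nat) : seq cell :=
  (0%N, (n - k - 1)%N) ::
  [seq (1%N, c) | c <- iota 0 (n - k - 1)] ++
  [seq (r, 0%N) | r <- iota 2 k].

(* A filling of a shape is given by a sequence s of cells: s`_a is the cell
   containing the entry a+1.  It is a standard Young tableau of the shape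
   iff s is an enumeration of the cells (without repetition) and rows and
   columns increase. *)
Definition is_standard (cells s : seq cell) : bool :=
  perm_eq s cells &&
  [forall a : 'I_(size s), forall b : 'I_(size s),
     let ca := nth (0%N, 0%N) s a in let cb := nth (0%N, 0%N) s b in
     (((ca.1 == cb.1) && (ca.2 < cb.2)%N) ==> (a < b)%N) &&
     (((ca.2 == cb.2) && (ca.1 < cb.1)%N) ==> (a < b)%N)].

Definition SYT (cells : seq cell) : seq (seq cell) :=
  [seq s <- permutations cells | is_standard cells s].

(* Des(T) in 0-based form: a (i.e. i = a+1 in [n-1]) such that the entry
   a+2 lies in a strictly lower row than a+1. *)
Definition Des_tab (s : seq cell) : seq nat :=
  [seq a <- iota 0 (size s).-1 |
     ((nth (0%N, 0%N) s a).1 < (nth (0%N, 0%N) s a.+1).1)%N].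

Definition cDes_tab (n k : nat) (s : seq cell) : {set 'I_n} :=
  [set a : 'I_n | ((a : nat) \in Des_tab s) ||
                  (((a : nat) == n.-1) && (size (Des_tab s) == k))].

(* Main.v *)
Require Import Defs.
From HB Require Import structures.
From mathcomp Require Import all_boot all_order all_algebra all_fingroup.
From mathcomp Require Import mpoly.
From mathcomp Require Import zify.
Local Open Scope ring_scope.

(** Both sides equal the sum of x^J over the pairs (c, J) with c in J and c - 1
    (cyclically) not in J, i.e. J is counted once for each of its cyclic runs.

    An arc permutation pi is sent to the position c of its maximum together with
    J = cDes(pi).  Prefixes ending before c and suffixes starting after c take
    values in genuine (non-cyclic) intervals, so each comparison pi(i) < pi(j),
    i < j, is governed by a single membership in J: that of j - 1 if j <= c, of
    i if c <= i, and of n if i < c < j.  These rules define a total order on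
    positions for every (c, J), whose rank function is the required pi.

    A tableau is sent to the entry c of the isolated cell together with
    J = cDes(T).  If L is the set of leg entries, then J consists of c, of l - 1
    for l in L, and of n if c + 1 is in L; L is recovered from (c, J), and a
    standard tableau is determined by c and L. *)

(** * Arc permutations *)

Section CyclicRuns.
Local Open Scope nat_scope.
Variable m : nat.
Implicit Types (c i j p q r : 'I_m.+1) (J : {set 'I_m.+1}) (pi : 'S_m.+1).

Definition run_start (u : 'I_m.+1 * {set 'I_m.+1}) : bool :=
  (u.1 \in u.2) && (ord_pred u.1 \notin u.2).

Lemma if_boolE (b x y : bool) : (if b then x else y) = b && x || ~~ b && y.
Proof. by case: b; rewrite ?orbF. Qed.

Lemma val_ordS i : ordS i = (if i == m :> nat then 0 else i.+1) :> nat.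
Proof.
rewrite /=; case: eqVneq => [->|]; first by rewrite modnn.
by move=> ?; rewrite modn_small //; have := ltn_ord i; lia.
Qed.

Lemma val_ord_pred i : ord_pred i = (if i == 0 :> nat then m else i.-1) :> nat.
Proof.
rewrite /=; case: eqVneq => [->|ne0]; first by rewrite modn_small.
have ->: (i + m.+1).-1 = i.-1 + m.+1 by lia.
by rewrite modnDr modn_small //; have := ltn_ord i; lia.
Qed.

(** * Cyclic intervals and images of prefixes *)

Lemma cyc_distE (a x : 'I_m.+1) :
  (x + m.+1 - a) %% m.+1 = if a <= x then x - a else x + m.+1 - a.
Proof.
have la := ltn_ord a; have lx := ltn_ord x.
case: (leqP a x) => ax; last by rewrite modn_small //; lia.
have ->: x + m.+1 - a = (x - a) + m.+1 by lia.
by rewrite modnDr modn_small //; lia.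
Qed.

Lemma in_cyc_interval (k : nat) (a x : 'I_m.+1) :
  (x \in cyc_interval k a) =
    (a <= x) && (x - a < k) || (x < a) && (x + m.+1 - a < k).
Proof. by rewrite inE cyc_distE; case: (leqP a x) => _; rewrite ?orbF. Qed.

Lemma card_ord_lt (k : nat) : k <= m.+1 -> #|[set y : 'I_m.+1 | y < k]| = k.
Proof.
move=> lek; rewrite -sum1_card (eq_bigl (fun y : 'I_m.+1 => y < k)).
  by rewrite (big_ord_narrow lek) sum1_card card_ord.
by move=> y; rewrite inE.
Qed.

(** Rotation by [a] is injective, and the interval is the preimage of the first [k] residues. *)
Lemma card_cyc_interval (k : nat) (a : 'I_m.+1) :
  k <= m.+1 -> #|cyc_interval k a| = k.
Proof.
move=> lek; pose f (x : 'I_m.+1) : 'I_m.+1 := inord ((x + m.+1 - a) %% m.+1).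
have fE x : f x = (x + m.+1 - a) %% m.+1 :> nat.
  by rewrite inordK // ltn_mod.
have f_inj : injective f.
  move=> x y /(congr1 val) /=; rewrite !fE => exy; apply: val_inj => /=.
  move: exy; rewrite !cyc_distE; have := ltn_ord x; have := ltn_ord y; have := ltn_ord a.
  by case: (leqP a x); case: (leqP a y); lia.
rewrite -[RHS](card_ord_lt _ lek) -(card_preimset _ f_inj).
by congr #|pred_of_set _|; apply/setP=> x; rewrite !inE fE.
Qed.

Definition prefix_set pi (k : nat) : {set 'I_m.+1} :=
  [set pi p | p : 'I_m.+1 & p < k].

Lemma in_prefix_set pi k p : (pi p \in prefix_set pi k) = (p < k).
Proof. by rewrite (mem_imset _ _ (@perm_inj _ pi)) inE. Qed.

Lemma card_prefix_set pi k : k <= m.+1 -> #|prefix_set pi k| = k.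
Proof.
move=> lek; rewrite card_imset; last exact: perm_inj.
by rewrite -[RHS](card_ord_lt _ lek); apply: eq_card => x; rewrite !inE.
Qed.

Lemma is_arcP pi :
  reflect (forall k, 0 < k <= m.+1 -> exists a, prefix_set pi k = cyc_interval k a)
          (is_arc pi).
Proof.
apply: (iffP forallP) => [H k /andP[k0 lek]|H k].
  by have /implyP/(_ k0)/existsP[a /eqP] := H (Ordinal (lek : k < m.+2)); exists a.
apply/implyP => k0; have [|a e] := H k; first by rewrite k0 -ltnS ltn_ord.
by apply/existsP; exists a; apply/eqP.
Qed.

(** * Arc permutations through convexity of prefixes and suffixes *)

Lemma arc_prefix_convex pi c (k : nat) p q r :
  is_arc pi -> pi c = ord_max -> k <= c -> p < k -> r < k ->
  pi p < pi q < pi r -> q < k.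
Proof.
move=> /is_arcP arc pic kc pk rk.
(* Positions below [k] omit [c], so the cyclic interval of their values omits [m] and cannot wrap
   around. *)
have [|a ea] := arc k; first by have := ltn_ord c; lia.
have E (x : 'I_m.+1) : (x < k) = (pi x \in cyc_interval k a) by rewrite -ea in_prefix_set.
move: (E p) (E q) (E r) (E c); rewrite !in_cyc_interval pic /=.
have := ltn_ord (pi p); have := ltn_ord (pi q); have := ltn_ord (pi r).
have := ltn_ord a; lia.
Qed.

(** The complement of a cyclic interval is cyclic; here the prefix contains the value [m], so the
    values of the suffix do not wrap around. *)
Lemma arc_suffix_convex pi c (k : nat) p q r :
  is_arc pi -> pi c = ord_max -> c < k -> k <= p -> k <= r ->
  pi p < pi q < pi r -> k <= q.
Proof.
move=> /is_arcP arc pic kc pk rk.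
have [|a ea] := arc k; first by have := ltn_ord p; lia.
have E (x : 'I_m.+1) : (x < k) = (pi x \in cyc_interval k a) by rewrite -ea in_prefix_set.
move: (E p) (E q) (E r) (E c); rewrite !in_cyc_interval pic /=.
have := ltn_ord (pi p); have := ltn_ord (pi q); have := ltn_ord (pi r).
have := ltn_ord a; lia.
Qed.

(** Converse of the two convexity facts: a convex set of values is the interval between its
    extremes, and for [c < k] the prefix is the complement of such a set. *)
Lemma convex_is_arc pi c : pi c = ord_max ->
  (forall (k : nat) p q r, k <= c -> p < k -> r < k ->
     pi p < pi q < pi r -> q < k) ->
  (forall (k : nat) p q r, c < k -> k <= p -> k <= r ->
     pi p < pi q < pi r -> k <= q) ->
  is_arc pi.
Proof.
move=> pic pre suf; apply/is_arcP => k /andP[k0 lek].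
(* The length need not be tracked: cardinality forces [l = k]. *)
suff [l [a [lel ea]]] : exists l a, l <= m.+1 /\ prefix_set pi k = cyc_interval l a.
  exists a; rewrite ea; congr cyc_interval.
  by rewrite -(card_prefix_set pi k lek) ea card_cyc_interval.
have setE (A : {set 'I_m.+1}) : (forall p, (p < k) = (pi p \in A)) ->
    prefix_set pi k = A.
  by move=> H; apply/setP=> x; rewrite -(permKV pi x) in_prefix_set H.
have pi_eq p q : pi p = pi q :> nat -> p = q by move/val_inj/perm_inj.
have [kc|ck] := leqP k c.
  have z : (ord0 : 'I_m.+1) < k by [].
  case: (arg_minnP (P := fun p : 'I_m.+1 => p < k) (fun p => pi p : nat) z) => p0 p0k min0.
  case: (arg_maxnP (P := fun p : 'I_m.+1 => p < k) (fun p => pi p : nat) z) => p1 p1k max1.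
  exists (pi p1 - pi p0).+1, (pi p0); split; first by have := ltn_ord (pi p1); lia.
  apply: setE => q; rewrite in_cyc_interval.
  have := ltn_ord (pi q); have := ltn_ord (pi p0); have := ltn_ord (pi p1).
  move: (min0 q) (max1 q) (min0 p1 p1k) (pre k p0 q p1 kc p0k p1k) (pi_eq q p0) (pi_eq q p1).
  case: (ltnP q k) => qk /= mi ma le01 pr e0 e1 *.
    by move: (mi isT) (ma isT); lia.
  have q0 : pi q <> pi p0 :> nat by move/e0 => eq; move: qk p0k; rewrite eq; lia.
  have q1 : pi q <> pi p1 :> nat by move/e1 => eq; move: qk p1k; rewrite eq; lia.
  lia.
(* The suffix is nonempty unless [k = m.+1], when the prefix takes all values. *)
have [z|km] := leqP k m; last first.
  exists m.+1, ord0; split=> //; apply: setE => q; rewrite in_cyc_interval /=.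
  by have := ltn_ord q; have := ltn_ord (pi q); lia.
have {}z : k <= (ord_max : 'I_m.+1) by [].
case: (arg_minnP (P := fun p : 'I_m.+1 => k <= p) (fun p => pi p : nat) z) => p0 p0k min0.
case: (arg_maxnP (P := fun p : 'I_m.+1 => k <= p) (fun p => pi p : nat) z) => p1 p1k max1.
(* The value [m] sits at [c], before the suffix, so [(pi p1).+1] is still a residue and [inord]
   keeps it. *)
have b1 : pi p1 < m.
  have := ltn_ord (pi p1); rewrite ltnS leq_eqVlt => /orP[/eqP e|//].
  have /perm_inj pc : pi p1 = pi c by apply: val_inj; rewrite pic.
  by move: p1k; rewrite pc; lia.
(* The cyclic complement of the values from [pi p0] to [pi p1] starts just after [pi p1]. *)
exists (m.+1 - (pi p1 - pi p0).+1), (inord (pi p1).+1); split; first by lia.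
apply: setE => q; rewrite in_cyc_interval inordK //.
have := ltn_ord (pi q); have := ltn_ord (pi p0); have := ltn_ord (pi p1).
move: (min0 q) (max1 q) (min0 p1 p1k) (suf k p0 q p1 ck p0k p1k) (pi_eq q p0) (pi_eq q p1).
case: (ltnP q k) => qk /= mi ma le01 pr e0 e1 *; last first.
  by move: (mi isT) (ma isT); lia.
have q0 : pi q <> pi p0 :> nat by move/e0 => eq; move: qk p0k; rewrite eq; lia.
have q1 : pi q <> pi p1 :> nat by move/e1 => eq; move: qk p1k; rewrite eq; lia.
lia.
Qed.

(* Only meaningful for i < j. *)
Definition arc_asc c J i j : bool :=
  if j <= c then ord_pred j \notin J
  else if c <= i then i \notin J else ord_max \in J.

(** * The order on positions attached to [c] and [J] *)

Definition arc_lt c J i j : bool :=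
  if i < j then arc_asc c J i j else (j < i) && ~~ arc_asc c J j i.

Lemma arc_ltE pi c i j : is_arc pi -> pi c = ord_max ->
  (pi i < pi j) = arc_lt c (cDes_perm pi) i j.
Proof.
move=> arc pic.
have pi_eq p q : pi p = pi q :> nat -> p = q :> nat by move/val_inj/perm_inj->.
suff asc p q : p < q -> (pi p < pi q) = arc_asc c (cDes_perm pi) p q.
  rewrite /arc_lt; case: (ltngtP i j) => [ij|ji|/val_inj ->]; rewrite ?ltnn //=.
    exact: asc.
  by rewrite -asc // -leqNgt leq_eqVlt; move: (pi_eq i j); lia.
move=> pq; rewrite /arc_asc; case: (leqP q c) => [qc|cq].
  rewrite inE ord_predK.
  have vq : ord_pred q = q.-1 :> nat by rewrite val_ord_pred; case: eqVneq; lia.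
  (* The prefix of length [q] contains [p] and [ord_pred q] but not [q], so [pi q] lies on the same
     side of both their values. *)
  have := arc_prefix_convex pi c q p q (ord_pred q) arc pic qc pq.
  have := arc_prefix_convex pi c q (ord_pred q) q p arc pic qc.
  have := pi_eq p q; have := pi_eq (ord_pred q) q.
  by rewrite vq; lia.
case: (leqP c p) => [cp|pc].
  rewrite inE.
  have vp : ordS p = p.+1 :> nat.
    by rewrite val_ordS; case: eqVneq; have := ltn_ord q; lia.
  (* The suffix from [p.+1] contains [ordS p] and [q] but not [p]. *)
  have := arc_suffix_convex pi c p.+1 (ordS p) p q arc pic.
  have := arc_suffix_convex pi c p.+1 q p (ordS p) arc pic.
  have := pi_eq p q; have := pi_eq p (ordS p).
  by rewrite vp; lia.
have e0 : ordS (ord_max : 'I_m.+1) = ord0 by apply: val_inj; rewrite /= modnn.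
rewrite inE e0.
(* For [p < c < q], the prefix before [c] lets position 0 replace [p], then the suffix after [c]
   lets the last position replace [q]. *)
have := arc_prefix_convex pi c c p q ord0 arc pic.
have := arc_prefix_convex pi c c ord0 q p arc pic.
have := arc_suffix_convex pi c c.+1 q ord0 ord_max arc pic.
have := arc_suffix_convex pi c c.+1 ord_max ord0 q arc pic.
have := pi_eq p q; have := pi_eq ord0 q; have := pi_eq ord0 ord_max.
by have := ltn_ord q; rewrite /=; lia.
Qed.

Lemma arc_lt_irr c J i : arc_lt c J i i = false.
Proof. by rewrite /arc_lt ltnn. Qed.

Lemma arc_lt_total c J i j : i != j -> arc_lt c J i j = ~~ arc_lt c J j i.
Proof.
rewrite /arc_lt -val_eqE /=; case: ltngtP => //= _ _; by rewrite negbK.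
Qed.

(** Each comparison reads a bit attached to one of its two positions, or the common bit of
    [ord_max]. Once the bits at [c] are fixed by [run_start], three positions leave only a finite
    check. *)
Lemma arc_lt_trans c J : run_start (c, J) -> transitive (arc_lt c J).
Proof.
case/andP=> /= cJ pJ j i k.
have [->|ij] := eqVneq i j; first by rewrite arc_lt_irr.
have [->|jk] := eqVneq j k; first by rewrite arc_lt_irr.
have [<-|ik] := eqVneq i k; first by rewrite (arc_lt_total _ _ i) // => /negbTE->.
have V (x : 'I_m.+1) : (x = c :> nat -> (x \in J) /\ ~~ (ord_pred x \in J)) by move/val_inj->.
move: (V i) (V j) (V k) ij jk ik; rewrite -!val_eqE /= /arc_lt /arc_asc !if_boolE {V cJ pJ}.
move: (i \in J) (j \in J) (k \in J) (ord_max \in J) => xi xj xk e.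
move: (ord_pred i \in J) (ord_pred j \in J) (ord_pred k \in J) => yi yj yk.
lia.
Qed.

(** * Realizing the order by a unique arc permutation *)

Definition arc_rank c J i : 'I_m.+1 := inord #|[set j | arc_lt c J j i]|.

(** A position is not below itself, so at most [m] positions are counted and [inord] does not
    truncate. *)
Lemma arc_rankE c J i : arc_rank c J i = #|[set j | arc_lt c J j i]| :> nat.
Proof.
rewrite /arc_rank inordK // -[X in _ < X](card_ord m.+1); apply: proper_card.
by apply/properP; split; [exact: subset_predT|exists i; rewrite ?inE ?arc_lt_irr].
Qed.

(** Transitivity nests the lower sets, and irreflexivity makes the inclusion strict. *)
Lemma arc_rank_lt c J i j : run_start (c, J) ->
  (arc_rank c J i < arc_rank c J j) = arc_lt c J i j.
Proof.
move=> v.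
have mono p q : arc_lt c J p q -> arc_rank c J p < arc_rank c J q.
  move=> pq; rewrite !arc_rankE; apply: proper_card; apply/properP; split.
    by apply/subsetP=> x; rewrite !inE => /arc_lt_trans; apply.
  by exists p; rewrite !inE ?arc_lt_irr.
have [->|ij] := eqVneq i j; first by rewrite ltnn arc_lt_irr.
apply/idP/idP => [lt|]; last exact: mono.
by rewrite arc_lt_total //; apply/negP=> /mono; lia.
Qed.

Lemma arc_rank_inj c J : run_start (c, J) -> injective (arc_rank c J).
Proof.
move=> v i j e; apply/eqP/negPn/negP => ij.
have := arc_rank_lt c J i j v; have := arc_rank_lt c J j i v.
by rewrite e ltnn (arc_lt_total _ _ i) // => <-.
Qed.

(** The two conditions of [run_start] put every other position below [c], and the bijective rank
    attains its top value somewhere. *)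
Lemma arc_rank_max c J : run_start (c, J) -> arc_rank c J c = ord_max.
Proof.
move=> v; have [g fg gf] := injF_bij (arc_rank_inj c J v).
have [e|ne] := eqVneq (g ord_max) c; first by rewrite -{2}e gf.
have : arc_lt c J (g ord_max) c.
  case/andP: (v) => /= cJ pJ; rewrite /arc_lt /arc_asc leqnn cJ pJ.
  by move: ne; rewrite -val_eqE /=; case: ltngtP.
by rewrite -arc_rank_lt // gf /= ltnNge -ltnS ltn_ord.
Qed.

Lemma arc_exists c J : 0 < m -> run_start (c, J) ->
  exists pi, [/\ is_arc pi, pi c = ord_max & cDes_perm pi = J].
Proof.
move=> m0 v; pose pi := perm (arc_rank_inj c J v).
have pic : pi c = ord_max by rewrite permE arc_rank_max.
have ltE i j : (pi i < pi j) = arc_lt c J i j by rewrite !permE arc_rank_lt.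
exists pi; split=> //.
  (* For [q] outside the prefix or suffix, its comparisons with [p] and with [r] read the same bit,
     so its value is never strictly between theirs. *)
  apply: (convex_is_arc pi c pic) => k p q r kc pk rk; rewrite !ltE /arc_lt /arc_asc !if_boolE.
    by move: (ord_pred q \in J); lia.
  by move: (q \in J); lia.
apply/setP => p; rewrite inE ltE.
case/andP: (v) => /= cJ pJ.
have V (x : 'I_m.+1) : (x = c :> nat -> (x \in J) /\ ~~ (ord_pred x \in J)) by move/val_inj->.
have e0 : p = m :> nat -> p = ord_max by move=> ?; apply: val_inj.
(* The wrap-around pair of positions [m] and 0 is treated apart: it reads the bit of [ord_max] when
   [c] is strictly between, and otherwise [c] is one of the two. *)
rewrite /arc_lt /arc_asc !if_boolE ordSK; have := val_ordS p; case: eqVneq => [/e0 e|pm] vS.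
  have eS : ordS p = ord0 by apply: val_inj.
  have ep : ord_pred (ordS p) = p by rewrite ordSK.
  have := V p; have := V (ordS p).
  rewrite ep eS e /=; rewrite eS e in ep; rewrite ?ep.
  move: (ord0 \in J) (ord_max \in J) (ord_pred ord_max \in J) => x y z.
  by have := ltn_ord c; lia.
have := V p; have := V (ordS p); rewrite ordSK vS.
move: (p \in J) (ordS p \in J) (ord_pred p \in J) => x y z.
lia.
Qed.

(** All comparisons are determined by [c] and the cyclic descent set, and a permutation is its own
    rank function. *)
Lemma arc_unique pi sigma c : is_arc pi -> is_arc sigma ->
  pi c = ord_max -> sigma c = ord_max -> cDes_perm pi = cDes_perm sigma ->
  pi = sigma.
Proof.
move=> api asi pic sic eJ; apply/permP => i.
have rank (tau : 'S_m.+1) : tau i = #|[set j | tau j < tau i]| :> nat.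
  rewrite -[LHS](card_ord_lt _ (ltnW (ltn_ord (tau i)))).
  rewrite -[LHS](card_preimset _ (@perm_inj _ tau)).
  by congr #|pred_of_set _|; apply/setP=> x; rewrite !inE.
apply: val_inj; rewrite /= rank [RHS]rank.
congr #|pred_of_set _|; apply/setP=> j; rewrite !inE.
by rewrite (arc_ltE pi c) // (arc_ltE sigma c) // eJ.
Qed.

Lemma arc_run_start pi c : 0 < m -> pi c = ord_max -> run_start (c, cDes_perm pi).
Proof.
move=> m0 pic; rewrite /run_start /= !inE ord_predK pic /=; apply/andP; split;
  last by rewrite -leqNgt -ltnS ltn_ord.
have := ltn_ord (pi (ordS c)); rewrite ltnS leq_eqVlt => /orP[/eqP e|//].
have /perm_inj/(congr1 (@nat_of_ord m.+1)) : pi (ordS c) = pi c by apply: val_inj; rewrite pic.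
by rewrite val_ordS; case: eqVneq; lia.
Qed.

Local Open Scope ring_scope.

Lemma sum_arc : (0 < m)%N ->
  \sum_(pi : 'S_m.+1 | is_arc pi) xJ (cDes_perm pi) = \sum_(u | run_start u) xJ u.2.
Proof.
move=> m0; pose g (pi : 'S_m.+1) := ((pi^-1)%g ord_max, cDes_perm pi).
have gmax pi : pi (g pi).1 = ord_max by rewrite permKV.
rewrite -big_enum -[RHS]big_enum /=.
rewrite -[LHS](big_map g predT (fun u => xJ u.2)).
apply: perm_big; apply: uniq_perm; last 1 first.
- case=> c J; rewrite mem_enum; apply/mapP/idP => [[pi api e]|v].
    by rewrite e; exact: arc_run_start m0 (gmax pi).
  have [pi [api pic eJ]] := arc_exists c J m0 v.
  by exists pi; rewrite ?mem_enum // /g eJ -pic permK.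
- rewrite map_inj_in_uniq ?enum_uniq // => pi sigma.
  rewrite !mem_enum => api asi [e eJ].
  apply: (arc_unique pi sigma (g pi).1) => //; rewrite ?gmax //=.
  by rewrite e permKV.
- exact: enum_uniq.
Qed.

End CyclicRuns.

(** * Tableaux of shape hook plus one cell *)

Section HookTableaux.
Local Open Scope nat_scope.

Lemma count_iota_before (P : pred nat) (n a : nat) : a <= n ->
  count (fun b => (b < a) && P b) (iota 0 n) = count P (iota 0 a).
Proof.
move=> an; rewrite -(subnKC an) iotaD count_cat add0n.
rewrite [X in _ + X](eq_in_count (a2 := pred0)) ?count_pred0 ?addn0.
  by apply: eq_in_count => b; rewrite mem_iota /= => ->.
by move=> b; rewrite mem_iota => /andP[ab _]; rewrite ltnNge ab.
Qed.

Lemma count_iota_lt (P : pred nat) (a b : nat) : a < b -> P a ->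
  count P (iota 0 a) < count P (iota 0 b).
Proof.
move=> ab Pa; rewrite -(subnKC ab) addSnnS iotaD count_cat /= add0n Pa.
lia.
Qed.

Lemma count_split3 (l : pred nat) (c : nat) (t : seq nat) : l c = false ->
  count l t + count (pred1 c) t + count (fun b => (b != c) && ~~ l b) t = size t.
Proof.
move=> lc; elim: t => //= b t IH.
by case: (eqVneq b c) => [->|_]; rewrite ?lc /=; [|case: (l b) => /=]; lia.
Qed.

Variable m : nat.
Local Notation n := m.+1.
Local Notation x0 := (0, 0).

(** * The cells of the shape, and data describing a filling *)

Lemma mem_hook_plus_cell (k : nat) (x : cell) : k < m ->
  (x \in hook_plus_cell n k) =
  [|| x == (0, m - k), (x.1 == 1) && (x.2 < m - k) | (1 < x.1 < k.+2) && (x.2 == 0)].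
Proof.
case: x => r q km; rewrite inE mem_cat /=.
have -> : n - k - 1 = m - k by lia.
congr (_ || (_ || _)).
  apply/mapP/andP => [[p]|[/eqP -> qm]].
    by rewrite mem_iota => /andP[_ pm] [-> ->].
  by exists q; rewrite // mem_iota.
apply/mapP/andP => [[p]|[rk /eqP ->]].
  by rewrite mem_iota => pm [-> ->]; split=> //; lia.
by exists r; rewrite // mem_iota; lia.
Qed.

Lemma size_hook_plus_cell (k : nat) : k < m -> size (hook_plus_cell n k) = n.
Proof. by move=> km; rewrite /= size_cat !size_map !size_iota; lia. Qed.

Lemma uniq_hook_plus_cell (k : nat) : uniq (hook_plus_cell n k).
Proof.
rewrite /= mem_cat cat_uniq !map_inj_uniq ?iota_uniq //=; last 2 first.
- by move=> a b [].
- by move=> a b [].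
rewrite andbT; apply/andP; split.
  by apply/norP; split; apply/mapP => -[p] //; rewrite mem_iota => ? []; lia.
apply/hasPn => x /mapP[p]; rewrite mem_iota => pr ->.
by apply/mapP => -[q _ []]; lia.
Qed.

Lemma count_hook_legs (k : nat) (q : nat) : q <= k.+2 ->
  count (fun x : cell => 1 < x.1 < q) (hook_plus_cell n k) = q - 2.
Proof.
move=> qk; rewrite /= count_cat !count_map /=.
rewrite (eq_count (a2 := pred0)) ?count_pred0 //= !add0n.
rewrite (eq_in_count (a2 := fun r => r < q)); last first.
  by move=> r; rewrite mem_iota /=; lia.
case: (leqP q 2) => q2.
  rewrite (eq_in_count (a2 := pred0)) ?count_pred0; first by lia.
  by move=> r; rewrite mem_iota /=; lia.
have {1}-> : k = (q - 2) + (k.+2 - q) by lia.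
rewrite iotaD count_cat (eq_in_count (a2 := predT)); last first.
  by move=> r; rewrite mem_iota /=; lia.
rewrite [X in _ + X](eq_in_count (a2 := pred0)); last first.
  by move=> r; rewrite mem_iota /=; lia.
by rewrite count_predT count_pred0 size_iota addn0.
Qed.

Lemma count_hook_arm (k q : nat) : q <= m - k ->
  count (fun x : cell => (x.1 == 1) && (x.2 < q)) (hook_plus_cell n k) = q.
Proof.
move=> qk; rewrite /= count_cat !count_map /=.
rewrite [X in _ + (_ + X)](eq_in_count (a2 := pred0)); last first.
  by move=> r; rewrite mem_iota /=; lia.
rewrite count_pred0 addn0 add0n.
rewrite (eq_count (a2 := fun r => (r < q) && predT r)); last by move=> r; rewrite /= andbT.
by rewrite count_iota_before ?count_predT ?size_iota //; lia.
Qed.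

(** Row 0 is the isolated cell and row 1 the arm with the corner, so the leg starts at row 2. *)
Definition tab_leg (s : seq cell) (a : nat) : bool := 1 < (nth x0 s a).1.

(** The placement forced by [c] and the leg entries [l]: leg entries go down and arm entries go
    right in increasing order. The corner counts as an arm cell. *)
Definition tab_cell (k c : nat) (l : pred nat) (a : nat) : cell :=
  if a == c then (0, m - k)
  else if l a then ((count l (iota 0 a)).+2, 0)
  else (1, count (fun b => (b != c) && ~~ l b) (iota 0 a)).

(** The least entry other than [c] must occupy the corner: it is 0, or 1 when [c] is 0. *)
Definition leg_pred (k c : nat) (l : pred nat) : Prop :=
  [/\ l 0 = false, l c = false, c = 0 -> l 1 = false & count l (iota 0 n) = k].

(** * Structure and descents of a given standard tableau *)

Section Standard.
Variables (k : nat) (s : seq cell).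
Hypotheses (km : k < m) (sP : is_standard (hook_plus_cell n k) s).
Let c := index (0, m - k) s.

Lemma std_perm : perm_eq s (hook_plus_cell n k).
Proof. by case/andP: sP. Qed.

Lemma std_size : size s = n.
Proof. by rewrite (perm_size std_perm) size_hook_plus_cell. Qed.

Lemma std_uniq : uniq s.
Proof. by rewrite (perm_uniq std_perm) uniq_hook_plus_cell. Qed.

Lemma std_mem (a : nat) : a < n -> nth x0 s a \in hook_plus_cell n k.
Proof. by move=> an; rewrite -(perm_mem std_perm) mem_nth // std_size. Qed.

Lemma std_increasing (a b : nat) : a < n -> b < n ->
  (((nth x0 s a).1 == (nth x0 s b).1) && ((nth x0 s a).2 < (nth x0 s b).2)
     -> a < b) /\
  (((nth x0 s a).2 == (nth x0 s b).2) && ((nth x0 s a).1 < (nth x0 s b).1)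
     -> a < b).
Proof.
rewrite -std_size => an bn; case/andP: sP => _ /forallP/(_ (Ordinal an)).
by move=> /forallP/(_ (Ordinal bn)) /= /andP[/implyP ? /implyP ?].
Qed.

Lemma std_single_lt : c < n.
Proof. by rewrite -std_size index_mem (perm_mem std_perm) mem_hook_plus_cell // eqxx. Qed.

Lemma std_nth_single : nth x0 s c = (0, m - k).
Proof. by rewrite nth_index // -index_mem std_size std_single_lt. Qed.

Lemma std_row0 (a : nat) : a < n -> ((nth x0 s a).1 == 0) = (a == c).
Proof.
move=> an; have := std_mem a an; rewrite mem_hook_plus_cell //.
case: (eqVneq a c) => [->|ac]; first by rewrite std_nth_single.
have : nth x0 s a != nth x0 s c.
  by rewrite nth_uniq ?std_uniq ?std_size ?std_single_lt.
by rewrite std_nth_single => /negbTE->; lia.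
Qed.

Lemma std_count (P : pred cell) (Q : pred nat) :
  (forall a, a < n -> P (nth x0 s a) = Q a) ->
  count Q (iota 0 n) = count P (hook_plus_cell n k).
Proof.
move=> PQ; rewrite -(seq.permP std_perm P) -[in RHS](mkseq_nth x0 s) std_size.
rewrite /mkseq count_map; apply: eq_in_count => a; rewrite mem_iota => an.
by rewrite /= PQ.
Qed.

Lemma std_corner : exists2 b, b < n & nth x0 s b = (1, 0).
Proof.
have h : (1, 0) \in s by rewrite (perm_mem std_perm) mem_hook_plus_cell //=; lia.
by exists (index (1, 0) s); rewrite ?nth_index // -std_size index_mem.
Qed.

(** The corner entry [b] precedes every leg entry by column monotonicity, and differs from [c]. *)
Lemma std_leg_pred : leg_pred k c (tab_leg s).
Proof.
have [b bn eb] := std_corner.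
have leg_after a : a < n -> tab_leg s a -> b < a.
  move=> an la; have := std_mem a an; rewrite mem_hook_plus_cell //.
  have [_] := std_increasing b a bn an; rewrite eb /=.
  move: la; rewrite /tab_leg; case: (nth x0 s a) => r q /=.
  by rewrite xpair_eqE; lia.
split.
- by apply/negP => /leg_after; lia.
- by rewrite /tab_leg std_nth_single.
- move=> c0; apply/negP => /leg_after; have := std_row0 b bn; rewrite eb /= c0.
  by lia.
- rewrite (std_count (fun x => 1 < x.1 < k.+2)) ?count_hook_legs //; first by lia.
  move=> a an; have := std_mem a an; rewrite mem_hook_plus_cell // /tab_leg.
  by case: (nth x0 s a) => r q; rewrite xpair_eqE /=; lia.
Qed.

(** The leg entries smaller than a given leg entry are exactly those in the leg cells above it;
    along the arm, the cells to the left play this role. *)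
Lemma std_nthE (a : nat) : a < n -> nth x0 s a = tab_cell k c (tab_leg s) a.
Proof.
move=> an; rewrite /tab_cell; case: (eqVneq a c) => [->|ac].
  exact: std_nth_single.
have := std_mem a an; rewrite mem_hook_plus_cell // => mema.
have := std_row0 a an; rewrite (negbTE ac) => ra.
case: ifP => la.
  have [rk q0] : (nth x0 s a).1 < k.+2 /\ (nth x0 s a).2 = 0.
    move: mema la ra; rewrite /tab_leg; case: (nth x0 s a) => r q.
    by rewrite xpair_eqE /=; lia.
  have : count (tab_leg s) (iota 0 a) = (nth x0 s a).1 - 2.
    rewrite -(count_iota_before _ n) ?(ltnW an) //.
    rewrite -(count_hook_legs k (nth x0 s a).1) ?(ltnW rk) //; apply: std_count => b bn.
    have [_ lt1] := std_increasing a b an bn.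
    have [_ lt2] := std_increasing b a bn an.
    have eab : a = b -> (nth x0 s a).1 = (nth x0 s b).1 by move->.
    have := nth_uniq x0 (s := s) (i := a) (j := b); rewrite std_size an bn std_uniq.
    move=> /(_ isT isT isT).
    have := std_mem b bn; rewrite mem_hook_plus_cell //.
    move: lt1 lt2 eab q0 la; rewrite /tab_leg.
    case: (nth x0 s a) => r q; case: (nth x0 s b) => r' q'.
    by rewrite !xpair_eqE /=; lia.
  move: la q0; rewrite /tab_leg; case: (nth x0 s a) => r q /= r1 -> e.
  by congr pair; lia.
have [rk q0] : (nth x0 s a).1 = 1 /\ (nth x0 s a).2 < m - k.
  move: mema la ra; rewrite /tab_leg; case: (nth x0 s a) => r q.
  by rewrite xpair_eqE /=; lia.
have : count (fun b => (b != c) && ~~ tab_leg s b) (iota 0 a) = (nth x0 s a).2.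
  rewrite -(count_iota_before _ n) ?(ltnW an) //.
  rewrite -[RHS](count_hook_arm k (nth x0 s a).2) ?(ltnW q0) //; apply: std_count => b bn.
  have [lt1 _] := std_increasing a b an bn.
  have [lt2 _] := std_increasing b a bn an.
  have eab : a = b -> (nth x0 s a).1 = (nth x0 s b).1 by move->.
  have := nth_uniq x0 (s := s) (i := a) (j := b); rewrite std_size an bn std_uniq.
  move=> /(_ isT isT isT).
  have := std_row0 b bn.
  move: lt1 lt2 eab rk la; rewrite /tab_leg.
  case: (nth x0 s a) => r q; case: (nth x0 s b) => r' q'.
  by rewrite !xpair_eqE /=; lia.
by move: rk; case: (nth x0 s a) => r q /= -> ->.
Qed.

Lemma std_cells : s = mkseq (tab_cell k c (tab_leg s)) n.
Proof.
rewrite -[LHS](mkseq_nth x0) std_size; apply/eq_in_map => a.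
by rewrite mem_iota => an; apply: std_nthE.
Qed.

(** Leg entries go down in increasing order, so the row increases exactly when the step leaves row 0
    or ends in the leg. *)
Lemma std_descent (a : nat) : a < m ->
  ((nth x0 s a).1 < (nth x0 s a.+1).1) = tab_leg s a.+1 || (a == c).
Proof.
move=> am; have an : a < n by lia.
have := std_row0 a an; have := std_row0 a.+1 am.
have : tab_leg s a -> tab_leg s a.+1 -> (nth x0 s a).1 < (nth x0 s a.+1).1.
  move=> la la1; rewrite !std_nthE // /tab_cell.
  have [_ lc _ _] := std_leg_pred.
  case: eqVneq => [e|_]; first by rewrite e lc in la.
  case: eqVneq => [e|_]; first by rewrite e lc in la1.
  by have := count_iota_lt _ a a.+1 (ltnSn a) la; rewrite la la1 /=; lia.
rewrite /tab_leg; case: (nth x0 s a) => r q; case: (nth x0 s a.+1) => r' q' /=.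
by lia.
Qed.

Lemma std_Des : Des_tab s = [seq a <- iota 0 m | tab_leg s a.+1 || (a == c)].
Proof.
rewrite /Des_tab std_size; apply: eq_in_filter => a.
by rewrite mem_iota => am; apply: std_descent.
Qed.

(** Leg entries account for [k] descents, each just before the entry. The only possible further one
    is at [c]: it is missing for [c = m] and already counted when [c.+1] is in the leg. *)
Lemma std_size_Des : (size (Des_tab s) == k) = (c == m) || tab_leg s c.+1.
Proof.
rewrite std_Des size_filter; have [l0 lc _ lk] := std_leg_pred.
have legS : count (fun a => tab_leg s a.+1) (iota 0 m) = k.
  rewrite -lk -(count_map S) /= l0 add0n; congr count.
  by rewrite -[1](addn0 1) iotaDl.
pose new a := (a == c) && ~~ tab_leg s a.+1.
have -> : count (fun a => tab_leg s a.+1 || (a == c)) (iota 0 m) =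
    k + count new (iota 0 m).
  rewrite -legS -size_filter; elim: (iota 0 m) => //= a t; rewrite /new.
  by case: (tab_leg s a.+1); case: (a == c) => /=; lia.
rewrite -{2}[k]addn0 eqn_add2l eqn0Ngt -has_count.
have cn := std_single_lt.
apply/hasPn/idP => [H|H a].
  case: (eqVneq c m) => //= cm; apply/negPn/negP => nl.
  have : c \in iota 0 m by rewrite mem_iota; lia.
  by move/H; rewrite /new eqxx nl.
rewrite mem_iota /new => am; apply/negP => /andP[/eqP ac]; rewrite ac.
by case/orP: H => [/eqP|->] //; lia.
Qed.

Lemma in_std_cDes (a : 'I_n) : (a \in cDes_tab n k s) =
  if a == m :> nat then (c == m) || tab_leg s c.+1
  else tab_leg s a.+1 || (a == c :> nat).
Proof.
rewrite inE std_size_Des std_Des mem_filter mem_iota /=.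
have an := ltn_ord a; case: (eqVneq (a : nat) m) => [->|am]; first by rewrite ltnn andbF.
by have -> : a < m by [lia]; rewrite andbT orbF.
Qed.

End Standard.

(** * Constructing a tableau from [c] and a leg predicate *)

Section Construct.
Variables (k c : nat) (l : pred nat).
Hypotheses (km : k < m) (cn : c < n) (lP : leg_pred k c l).
Let s := mkseq (tab_cell k c l) n.
Let arm b := (b != c) && ~~ l b.

Lemma count_arm : count arm (iota 0 n) = m - k.
Proof.
have [_ lc _ lk] := lP; have := count_split3 l c (iota 0 n) lc.
by rewrite size_iota lk count_uniq_mem ?iota_uniq // mem_iota add0n cn -/arm; lia.
Qed.

Lemma tab_cell_mem (a : nat) : a < n -> tab_cell k c l a \in hook_plus_cell n k.
Proof.
move=> an; rewrite mem_hook_plus_cell // /tab_cell; have [_ _ _ lk] := lP.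
case: (eqVneq a c) => [_|ac]; first by rewrite eqxx.
case: ifP => la /=.
  have := count_iota_lt l a n an la; rewrite lk; by lia.
by have := count_iota_lt arm a n an; rewrite /arm ac la count_arm /= => /(_ isT); lia.
Qed.

Lemma tab_cell_increasing (a b : nat) : a < n -> b < n ->
  let ca := tab_cell k c l a in let cb := tab_cell k c l b in
  ((ca.1 == cb.1) && (ca.2 < cb.2) -> a < b) /\
  ((ca.2 == cb.2) && (ca.1 < cb.1) -> a < b).
Proof.
case: (eqVneq a b) => [->|ab]; first by split; rewrite ltnn andbF.
move=> an bn; have := tab_cell_mem a an; have := tab_cell_mem b bn.
rewrite !mem_hook_plus_cell //= /tab_cell.
have [l0 lc l1 lk] := lP.
have := count_iota_lt l a b; have := count_iota_lt l b a.
have := count_iota_lt arm a b; have := count_iota_lt arm b a.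
(* Every leg entry comes after the corner entry, which is 0, or 1 if [c] is 0; hence an arm entry
   that follows a leg entry is not in column 0. *)
have a0 : l b -> b < a -> 0 < count arm (iota 0 a).
  move=> lb ba; rewrite -has_count; apply/hasP; rewrite /arm.
  case: (eqVneq c 0) => [c0|nc0].
    exists 1; last by rewrite c0 /= (l1 c0).
    by rewrite mem_iota; case: b lb ba {bn ab} => [|b]; rewrite ?l0 //; lia.
  by exists 0; rewrite ?mem_iota ?l0 ?andbT 1?eq_sym //; lia.
move: a0; rewrite /arm.
case: (eqVneq a c) => [->|ac]; case: (eqVneq b c) => [->|bc] //=;
  rewrite ?lc; try case: (l a); try case: (l b) => //=; rewrite ?xpair_eqE; lia.
Qed.

Lemma tab_std : is_standard (hook_plus_cell n k) s.
Proof.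
apply/andP; split; last first.
  apply/forallP => -[a an]; apply/forallP => -[b bn] /=.
  move: (an) (bn); rewrite !size_mkseq => an' bn'; rewrite !nth_mkseq //.
  have [h1 h2] := tab_cell_increasing a b an' bn'.
  by apply/andP; split; apply/implyP.
have us : uniq s.
  rewrite map_inj_in_uniq ?iota_uniq // => a b; rewrite !mem_iota !add0n.
  move=> /andP[_ an] /andP[_ bn] e.
  have := count_iota_lt l a b; have := count_iota_lt l b a.
  have := count_iota_lt arm a b; have := count_iota_lt arm b a.
  have [_ lc _ _] := lP; move: e; rewrite /tab_cell /arm.
  case: (eqVneq a c) => [->|ac]; case: (eqVneq b c) => [->|bc] //=;
    try case: (l a); try case: (l b) => //=; case; lia.
apply: uniq_perm => //; first exact: uniq_hook_plus_cell.
(* A duplicate-free list of cells of the shape, of full length, contains them all. *)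
have [||_ //] := uniq_min_size us (s2 := hook_plus_cell n k).
  by move=> x /mapP[a]; rewrite mem_iota => an ->; apply: tab_cell_mem.
by rewrite size_hook_plus_cell // size_mkseq.
Qed.

Lemma tab_legE (a : nat) : a < n -> tab_leg s a = l a.
Proof.
move=> an; rewrite /tab_leg nth_mkseq // /tab_cell.
by have [_ lc _ _] := lP; case: eqVneq => [->|_]; [rewrite lc|case: (l a)].
Qed.

Lemma tab_single : index (0, m - k) s = c.
Proof.
have sE := std_row0 k s km tab_std c cn.
by apply/esym/eqP; rewrite -sE nth_mkseq // /tab_cell eqxx.
Qed.

End Construct.

(* The leg entries recovered from (c, J); entries are 0-based. *)
Definition hook_leg (u : 'I_n * {set 'I_n}) (a : nat) : bool :=
  (0 < a) && (inord (if a.-1 == u.1 then m else a.-1) \in u.2).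

Definition hook_height (u : 'I_n * {set 'I_n}) : nat :=
  count (hook_leg u) (iota 0 n).

Definition tab_run (k : nat) (s : seq cell) : 'I_n * {set 'I_n} :=
  (inord (index (0, m - k) s), cDes_tab n k s).

(** That [ord_pred c] is outside [J] says that [c] is not a leg entry or, when [c] is 0 and its
    predecessor is [m], that 1 is not. *)
Lemma hook_leg_pred (u : 'I_n * {set 'I_n}) :
  0 < m -> run_start m u -> leg_pred (hook_height u) u.1 (hook_leg u).
Proof.
case: u => c J m0 /andP[/= cJ pJ].
have inJ (p : nat) : p = ord_pred c :> nat -> inord p \notin J.
  by move->; rewrite inord_val.
have vp := val_ord_pred m c.
split=> //; rewrite /hook_leg /=.
- case: (posnP c) => //= c0; apply/negbTE; apply: inJ; rewrite vp.
  by case: (c.-1 =P c); case: (nat_of_ord c =P 0); lia.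
- by move=> c0; apply/negbTE; apply: inJ; rewrite vp c0.
Qed.

(** Two entries are outside the leg: [c], and the corner entry, which is 0 or 1. *)
Lemma hook_height_lt (u : 'I_n * {set 'I_n}) :
  0 < m -> run_start m u -> hook_height u < m.
Proof.
move=> m0 v; have [l0 lc l1 _] := hook_leg_pred u m0 v.
have := count_split3 (hook_leg u) (u.1 : nat) (iota 0 n) lc.
rewrite size_iota (count_uniq_mem _ (iota_uniq _ _)) mem_iota /= add0n ltn_ord.
rewrite -/(hook_height u).
suff : 0 < count (fun b : nat => (b != u.1) && ~~ hook_leg u b) (iota 0 n).
  by rewrite /hook_height /=; lia.
rewrite -has_count; apply/hasP.
case: (eqVneq (u.1 : nat) 0) => [c0|nc0].
  by exists 1; rewrite ?mem_iota ?c0 ?(l1 c0) //; lia.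
by exists 0; rewrite ?mem_iota ?l0 1?eq_sym ?nc0.
Qed.

(** * The correspondence between tableaux and run starts *)

Section TabRun.
Variables (k : nat) (s : seq cell).
Hypotheses (km : k < m) (sP : is_standard (hook_plus_cell n k) s).

Lemma tab_run1 : (tab_run k s).1 = index (0, m - k) s :> nat.
Proof. by rewrite inordK // std_single_lt. Qed.

(** Entry [c] is an ordinary descent, or the cyclic one when it is last. Its predecessor would be
    one only if [c], or 1 when [c] is 0, were in the leg. *)
Lemma tab_run_start : run_start m (tab_run k s).
Proof.
have [l0 lc l1 _] := std_leg_pred k s km sP.
have cn := std_single_lt k s km sP.
rewrite /run_start !(in_std_cDes k) // val_ord_pred tab_run1.
set c := index _ _ in l0 lc l1 cn *.
case: (eqVneq c 0) => [c0|nc0].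
  by rewrite eqxx c0 l1 // eqxx orbT; case: eqVneq => //=; lia.
have -> : c.-1.+1 = c by lia.
rewrite lc eqxx orbT; have -> : (c.-1 == m) = false by lia.
have -> : (c.-1 == c) = false by lia.
by case: (c == m).
Qed.

(** Index [c] is always in the set, so whether [c.+1] is in the leg is read at the last index
    instead. *)
Lemma tab_run_leg (a : nat) : a < n -> hook_leg (tab_run k s) a = tab_leg s a.
Proof.
move=> an; have [l0 _ _ _] := std_leg_pred k s km sP.
rewrite /hook_leg; case: a an => [|a] an /=; first by rewrite l0.
have vE : (inord (if a == (tab_run k s).1 then m else a) : 'I_n) =
          (if a == (tab_run k s).1 then m else a) :> nat.
  by rewrite inordK //; case: ifP; lia.
rewrite (in_std_cDes k) // vE -tab_run1.
case: (eqVneq a (tab_run k s).1) => [<-|ne].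
  by rewrite eqxx; have -> : (a == m) = false by [lia].
by have -> : (a == m) = false by [lia]; rewrite /= ?(negbTE ne) orbF.
Qed.

Lemma tab_run_height : hook_height (tab_run k s) = k.
Proof.
have [_ _ _ lk] := std_leg_pred k s km sP; rewrite -[RHS]lk.
by apply: eq_in_count => a; rewrite mem_iota => an; apply: tab_run_leg.
Qed.

(** Rebuilding [s] from its image makes [tab_run k] injective on standard tableaux. *)
Lemma tab_run_cells :
  s = mkseq (tab_cell k (tab_run k s).1 (hook_leg (tab_run k s))) n.
Proof.
rewrite {1}(std_cells k s) //; apply/eq_in_map => a; rewrite mem_iota => an.
rewrite /tab_cell -tab_run1 tab_run_leg //.
case: eqP => // _; case: ifP => _; congr pair.
  congr _.+2; apply: eq_in_count => b; rewrite mem_iota => ba.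
  by rewrite tab_run_leg //; lia.
apply: eq_in_count => b; rewrite mem_iota => ba.
by rewrite tab_run_leg //; lia.
Qed.

End TabRun.

(** Placing the leg entries read off [u] by [tab_cell] gives a preimage; its cyclic descent set is
    then compared with [u.2] index by index, the last index and [c] apart. *)
Lemma tab_run_surj (u : 'I_n * {set 'I_n}) : 0 < m -> run_start m u ->
  exists2 s, is_standard (hook_plus_cell n (hook_height u)) s
           & u = tab_run (hook_height u) s.
Proof.
move=> m0 v; have km := hook_height_lt u m0 v.
have lP := hook_leg_pred u m0 v; have cn := ltn_ord u.1.
have sP := tab_std _ _ _ km cn lP.
exists (mkseq (tab_cell (hook_height u) u.1 (hook_leg u)) n) => //.
have cE := tab_single _ _ _ km cn lP.
rewrite /tab_run cE inord_val [LHS]surjective_pairing; congr pair.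
apply/setP => a; rewrite (in_std_cDes (hook_height u)) // cE.
have an := ltn_ord a.
have inJ (p : nat) : p = a -> inord p = a by move->; rewrite inord_val.
case/andP: (v) => cJ _.
case: (eqVneq (a : nat) m) => [am|am].
  case: (eqVneq (u.1 : nat) m) => [cm|cm] /=.
    by have -> : a = u.1 by apply: val_inj; rewrite /= am cm.
  rewrite tab_legE //; last by lia.
  by rewrite /hook_leg /= eqxx inJ.
rewrite tab_legE //; last by lia.
rewrite /hook_leg /=; case: (eqVneq (a : nat) u.1) => [/val_inj ->|_].
  by rewrite cJ orbT.
by rewrite inord_val orbF.
Qed.

Local Open Scope ring_scope.

Lemma sum_SYT (k : nat) : (0 < m)%N -> (k < m)%N ->
  \sum_(s <- SYT (hook_plus_cell n k)) xJ (cDes_tab n k s) =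
  \sum_(u | run_start m u && (hook_height u == k)) xJ u.2.
Proof.
move=> m0 km; rewrite -[RHS]big_enum /=.
rewrite -[LHS](big_map (tab_run k) predT (fun u => xJ u.2)).
have memS s : (s \in SYT (hook_plus_cell n k)) = is_standard (hook_plus_cell n k) s.
  by rewrite mem_filter mem_permutations; apply: andb_idr => /andP[].
apply: perm_big; apply: uniq_perm; last 1 first.
- move=> u; rewrite mem_enum; apply/mapP/andP => [[s]|[v /eqP uk]].
    by rewrite memS => sP ->; rewrite tab_run_start // tab_run_height.
  have [s sP e] := tab_run_surj u m0 v.
  by rewrite uk in sP e; exists s; rewrite ?memS.
- rewrite map_inj_in_uniq ?filter_uniq ?permutations_uniq // => s t.
  rewrite !memS => sP tP e.
  by rewrite (tab_run_cells k s) // (tab_run_cells k t) // e.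
- exact: enum_uniq.
Qed.

End HookTableaux.

Theorem theorem6p11 (n : nat) (hn : (2 <= n)%N) :
  \sum_(pi : 'S_n | is_arc pi) xJ (cDes_perm pi)
  = \sum_(0 <= k < n.-1) \sum_(s <- SYT (hook_plus_cell n k)) xJ (cDes_tab n k s).
Proof.
case: n hn => // m; rewrite ltnS => m0.
rewrite sum_arc // big_mkord /=.
rewrite (eq_bigr _ (fun (k : 'I_m) _ => sum_SYT m k m0 (ltn_ord k))).
(* After the exchange, each run start is met once, at [k] equal to its [hook_height], which is below
   [m]. *)
rewrite (exchange_big_dep (run_start m)) => [|k u _ /andP[]//] /=.
apply: eq_bigr => u v; rewrite v /=.
by rewrite (big_pred1 (Ordinal (hook_height_lt m u m0 v))) // => k; rewrite eq_sym.
Qed.
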